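(* Let $\mathcal{P}$ be a PTRS and let $\mathfrak{T}$ be a non-variable-decreasing $\to_{\mathcal{P}}$-RST with $\operatorname{h}(\mathfrak{T})>0$ whose root is labeled with the term $t$. If $\sum_{v\text{ leaf of }\mathfrak{T}} p_v\cdot \operatorname{maxNO}(t,t_v) > 1$, then $\mathcal{P}$ is not AST. If $\sum_{v\text{ leaf of }\mathfrak{T}} p_v\cdot \operatorname{maxNO}(t,t_v) \ge 1$, then $\mathcal{P}$ is not PAST.
   Context: Terms over a finite signature $\Sigma$ and variables $\mathcal{V}$; substitutions have finite domain and extend homomorphically. $\operatorname{Pos}(s)$ is the set of positions of $s$ ($\varepsilon$ the root), $s|_\pi$ the subterm at $\pi$, $s[r]_\pi$ replacement; $\operatorname{Pos}_\Sigma(t)$ is the set of positions of $t$ carrying a function symbol; $|s|_x$ is the number of positions of $s$ at which the variable $x$ occurs. A PTRS is a finite set of rules $\ell\to\{p_1:r_1,\dots,p_k:r_k\}$ ($\ell\notin\mathcal{V}$, $p_j>0$ summing to $1$, variables of each $r_j$ occur in $\ell$), inducing $s\to_{\mathcal{P}}\{p_1:s[r_1\sigma]_\pi,\dots,p_k:s[r_k\sigma]_\pi\}$ whenever $s|_\pi=\ell\sigma$. A $\to_{\mathcal{P}}$-RST is a (possibly infinite) tree whose nodes $v$ are labeled $(p_v:t_v)$ with $p_v\in(0,1]$, terms $t_v$, root probability $1$, and each non-leaf node $v$ with children $w_1,\dots,w_k$ satisfying $t_v\to_{\mathcal{P}}\{\tfrac{p_{w_1}}{p_v}:t_{w_1},\dots,\tfrac{p_{w_k}}{p_v}:t_{w_k}\}$;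 leaves need not be normal forms. $\operatorname{h}(\mathfrak{T})$ is the supremum of node depths. A $\to_{\mathcal{P}}$-RST with root term $t$ is non-variable-decreasing if $|t|_x\le|t_v|_x$ for every leaf $v$ and every variable $x$. For a $\to_{\mathcal{P}}$-RST $\mathfrak{T}$: $|\mathfrak{T}|=\sum_{v\text{ leaf}}p_v$; $\operatorname{edl}(\mathfrak{T})=\infty$ if $|\mathfrak{T}|<1$, else $\sum_{v\text{ leaf}}\operatorname{d}(v)p_v$ with $\operatorname{d}$ the depth. $\mathcal{P}$ is AST if $|\mathfrak{T}|=1$ for all $\to_{\mathcal{P}}$-RSTs, and PAST if $\operatorname{edl}(\mathfrak{T})<\infty$ for all of them. $t$ occurs in $s$ at position $\pi$ if $s|_\pi=t\sigma$ for some substitution $\sigma$. Positions $\pi_1,\pi_2$ are overlapping w.r.t. $t$ if there is $\tau\in\operatorname{Pos}_\Sigma(t)$ with $\pi_1=\pi_2.\tau$ or $\pi_2=\pi_1.\tau$. $\operatorname{NO}(t,s)$ is the set of all sets $S\subseteq\operatorname{Pos}(s)$ such that $t$ occurs in $s$ at every $\pi\in S$ and any two distinct positions of $S$ are non-overlapping w.r.t. $t$. $\operatorname{maxNO}(t,s)=\max_{S\in\operatorname{NO}(t,s)}|S|$. *)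

(* Defs.v *)
From HB Require Import structures.
From mathcomp Require Import all_boot all_order all_algebra finmap.
From mathcomp Require Import all_classical all_reals all_analysis.
Set Implicit Arguments.
Unset Strict Implicit.
Unset Printing Implicit Defensive.
Import Order.TTheory GRing.Theory Num.Theory.

Local Open Scope classical_set_scope.
Local Open Scope ring_scope.

Inductive term (Sigma : finType) (ar : Sigma -> nat) (V : Type) : Type :=
| Var of V
| Fun (f : Sigma) of ('I_(ar f) -> term ar V).

(* Classical decidable equality, only used to compare finite multisets. *)
HB.instance Definition _ (Sigma : finType) (ar : Sigma -> nat) (V : Type) :=
  gen_eqMixin (term ar V).

Section Terms.
Context {Sigma : finType} {ar : Sigma -> nat} {V : Type}.
Local Notation term := (term ar V).
Implicit Types (s t l : term) (x : V) (pi tau : seq nat) (sigma : V -> term).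

Definition is_var t : Prop := exists x, t = Var ar x.

(* Positions are sequences of argument indices, counted from 0. *)
Fixpoint pos_seq t : seq (seq nat) :=
  match t with
  | Var _ => [:: [::]]
  | Fun f a =>
      [::] :: flatten [seq [seq nat_of_ord i :: pi | pi <- pos_seq (a i)]
                      | i <- enum 'I_(ar f)]
  end.

Definition Pos t : {fset seq nat} := [fset pi | pi in pos_seq t]%fset.

(* [None] when [pi] is not a position of [s]. *)
Fixpoint subterm_at s pi : option term :=
  match pi with
  | [::] => Some s
  | i :: pi' =>
      match s with
      | Var _ => None
      | Fun f a =>
          if insub i is Some j then subterm_at (a j) pi' else None
      end
  end.

(* [s[r]_pi]; it is [s] when [pi] is not a position of [s]. *)
Fixpoint replace_at s pi r : term :=
  match pi with
  | [::] => r
  | i :: pi' =>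
      match s with
      | Var _ => s
      | Fun f a =>
          Fun (fun j : 'I_(ar f) =>
                 if nat_of_ord j == i then replace_at (a j) pi' r else a j)
      end
  end.

Definition fun_pos t pi : Prop :=
  exists f (a : 'I_(ar f) -> term), subterm_at t pi = Some (Fun a).

Definition var_pos x t pi : Prop := subterm_at t pi = Some (Var ar x).

Definition occurs_var x t : Prop := exists pi, var_pos x t pi.

Definition var_count x t : nat :=
  #|` [fset pi in Pos t | `[< var_pos x t pi >]]%fset |.

Definition is_subst sigma : Prop := finite_set [set x | sigma x <> Var ar x].

Fixpoint subst sigma t : term :=
  match t with
  | Var x => sigma x
  | Fun f a => Fun (fun i : 'I_(ar f) => subst sigma (a i))
  end.

Definition occurs_at t s pi : Prop :=
  exists sigma, is_subst sigma /\ subterm_at s pi = Some (subst sigma t).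

Definition overlapping t pi1 pi2 : Prop :=
  exists tau, fun_pos t tau /\ (pi1 = pi2 ++ tau \/ pi2 = pi1 ++ tau).

Definition NO t s (S : {fset seq nat}) : Prop :=
  [/\ (S `<=` Pos s)%fset,
      forall pi, pi \in S -> occurs_at t s pi
    & forall pi1 pi2, pi1 \in S -> pi2 \in S -> pi1 != pi2 ->
        ~ overlapping t pi1 pi2].

Definition maxNO t s : nat :=
  \max_(S <- fpowerset (Pos s) | `[< NO t s S >]) #|` S|.

End Terms.

Section Rewriting.
Context {R : realType} {Sigma : finType} {ar : Sigma -> nat} {V : Type}.
Local Notation term := (term ar V).

(* A multi-distribution is a list of (probability, term) pairs, always
   considered up to permutation. *)
Definition is_prule (l : term) (mu : seq (R * term)) : Prop :=
  [/\ ~ is_var l,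
      forall p, p \in mu -> 0 < p.1,
      \sum_(p <- mu) p.1 = 1
    & forall p, p \in mu -> forall x, occurs_var x p.2 -> occurs_var x l].

End Rewriting.

Record ptrs (R : realType) (Sigma : finType) (ar : Sigma -> nat) (V : Type) :=
  Ptrs {
  rules : set (term ar V * seq (R * term ar V));
  rules_finite : finite_set rules;
  rules_valid : forall l mu, rules (l, mu) -> is_prule l mu }.

Definition prewrites (R : realType) (Sigma : finType) (ar : Sigma -> nat)
    (V : Type) (P : ptrs R ar V) (s : term ar V) (nu : seq (R * term ar V)) :
    Prop :=
  exists l mu sigma pi,
    [/\ rules P (l, mu), is_subst sigma,
        subterm_at s pi = Some (subst sigma l)
      & perm_eq nu
          [seq (p.1, replace_at s pi (subst sigma p.2)) | p <- mu]].

(* Nodes are addressed by the path of child indices leading to them, so that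
   the depth of a node is the length of its address.  The values of [prob] and
   [label] outside [node] are irrelevant. *)
Record rst (R : realType) (Sigma : finType) (ar : Sigma -> nat) (V : Type)
    (P : ptrs R ar V) := Rst {
  node : set (seq nat);
  prob : seq nat -> R;
  label : seq nat -> term ar V;
  rst_root : node [::];
  rst_prefix : forall v i, node (rcons v i) -> node v;
  rst_prob_root : prob [::] = 1;
  rst_prob : forall v, node v -> 0 < prob v <= 1;
  rst_children : forall v, node v ->
    (forall i, ~ node (rcons v i)) \/
    exists k : nat,
      (forall i, node (rcons v i) <-> (i < k)%N) /\
      prewrites P (label v)
        [seq (prob (rcons v i) / prob v, label (rcons v i)) | i <- iota 0 k] }.

Section Trees.
Context {R : realType} {Sigma : finType} {ar : Sigma -> nat} {V : Type}.
Context {P : ptrs R ar V}.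
Local Open Scope ereal_scope.

Definition leaf (T : rst P) : set (seq nat) :=
  [set v | node T v /\ forall i, ~ node T (rcons v i)].

Definition height (T : rst P) : \bar R :=
  ereal_sup [set ((size v)%:R : R)%:E | v in node T].

Definition non_variable_decreasing (T : rst P) : Prop :=
  forall v, leaf T v ->
    forall x, (var_count x (label T [::]) <= var_count x (label T v))%N.

Definition leaf_mass (T : rst P) : \bar R :=
  \esum_(v in leaf T) (prob T v)%:E.

Definition edl (T : rst P) : \bar R :=
  if leaf_mass T < 1 then +oo
  else \esum_(v in leaf T) ((size v)%:R * prob T v)%:E.

End Trees.

Definition AST (R : realType) (Sigma : finType) (ar : Sigma -> nat) (V : Type)
    (P : ptrs R ar V) : Prop :=
  forall T : rst P, leaf_mass T = 1%E.

Definition PAST (R : realType) (Sigma : finType) (ar : Sigma -> nat) (V : Type)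
    (P : ptrs R ar V) : Prop :=
  forall T : rst P, (edl T < +oo)%E.

(* Main.v *)
(** Replay the tree [T] forever: whenever the current term contains
    non-overlapping occurrences of [t], put [T] (instantiated) at an outermost
    one. Being outermost, the replaced occurrence only has other occurrences
    below its variable positions, and these survive because a leaf of [T] has
    at least as many copies of every variable as [t]. So the number of
    non-overlapping occurrences is a random walk started in [1], with
    increments [maxNO t t_v - 1] and stopped in [0].

    For [th < 1] let [f th] be the sum over the leaves of
    [p_v * th ^ maxNO t t_v]. The potential [th ^ (number of occurrences)]
    increases in expectation by at most [d = max 0 (f th - th)] per replay of
    [T], so that [1 - th] is at most [d] times the expected derivation length
    plus the probability of not having stopped. If the expected number of
    occurrences in a leaf exceeds [c], then [f th <= 1 - c (1 - th)] for some
    [th < 1]. With [c = 1] this gives [d = 0] and the walk does not stop almost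
    surely; letting [c] tend to [1], the expected derivation length is
    infinite. *)
Require Import Defs.
From mathcomp Require Import all_boot all_order all_algebra finmap.
From mathcomp Require Import all_classical all_reals all_analysis.
From mathcomp Require Import ring lra.
Set Implicit Arguments.
Unset Strict Implicit.
Unset Printing Implicit Defensive.
Import Order.TTheory GRing.Theory Num.Theory.
Local Open Scope ring_scope.

(** * Positions, replacement and substitution *)

Section Positions.
Context {Sigma : finType} {ar : Sigma -> nat} {V : Type}.
Local Notation term := (Defs.term ar V).
Implicit Types (s t r l : term) (x : V) (pi tau rho : seq nat)
  (sigma : V -> term).

Lemma subterm_at_nil s : subterm_at s [::] = Some s.
Proof. by case: s. Qed.

Lemma replace_at_nil s r : replace_at s [::] r = r.
Proof. by case: s. Qed.

Lemma subterm_at_cat s pi tau :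
  subterm_at s (pi ++ tau) = obind (subterm_at^~ tau) (subterm_at s pi).
Proof.
elim: pi s => [s|i pi IH [x|f a]] //=; first by rewrite subterm_at_nil.
by case: insub => [j|//] /=.
Qed.

Lemma mem_Pos s pi : (pi \in Pos s) = isSome (subterm_at s pi).
Proof.
rewrite /Pos inE /=.
elim: s pi => [x|f a IH] [|i pi] //=.
rewrite inE /=; case: (insubP 'I_(ar f) i) => [j ltij jE|Nlt] /=.
  rewrite -IH; apply/flatten_mapP/idP => [[k _ /mapP[pi' pi'k [ik ->]]]|pij].
    suff -> : j = k by [].
    by apply: val_inj; rewrite jE.
  exists j; first by rewrite mem_enum.
  by apply/mapP; exists pi; rewrite // -jE.
apply/negbTE/negP => /flatten_mapP[k _ /mapP[pi' _ [ik _]]].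
by move: Nlt; rewrite ik ltn_ord.
Qed.

Lemma subterm_at_replace s pi r :
  isSome (subterm_at s pi) -> subterm_at (replace_at s pi r) pi = Some r.
Proof.
elim: pi s => [s _|i pi IH [x|f a]] //=.
  by rewrite replace_at_nil subterm_at_nil.
case: (insubP 'I_(ar f) i) => [j ltij jE|//] /= sN.
by rewrite jE eqxx IH.
Qed.

Lemma replace_at_cat s s' pi tau r : subterm_at s pi = Some s' ->
  replace_at s (pi ++ tau) r = replace_at s pi (replace_at s' tau r).
Proof.
elim: pi s => [s|i pi IH [x|f a]] //=.
  by rewrite subterm_at_nil => -[->]; rewrite ?replace_at_nil.
case: (insubP 'I_(ar f) i) => [j ltij jE|//] /= sN; congr Defs.Fun; apply/funext => k.
by case: eqP => // kE; apply: IH; rewrite -sN; congr (subterm_at (a _) _);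
   apply: val_inj; rewrite jE.
Qed.

Lemma replace_at_subterm s pi r : subterm_at s pi = Some r ->
  replace_at s pi r = s.
Proof.
elim: pi s => [s|i pi IH [x|f a]] //=.
  by rewrite subterm_at_nil => -[->]; rewrite ?replace_at_nil.
case: (insubP 'I_(ar f) i) => [j ltij jE|//] /= sN; congr Defs.Fun; apply/funext => k.
by case: eqP => // kE; apply: IH; rewrite -sN; congr (subterm_at (a _) _);
   apply: val_inj; rewrite jE.
Qed.

Lemma replace_at_replace s pi r r' :
  replace_at (replace_at s pi r) pi r' = replace_at s pi r'.
Proof.
elim: pi s => [s|i pi IH [x|f a]] //=; first by rewrite !replace_at_nil.
congr Defs.Fun; apply/funext => k.
by case: eqP => [_|_]; rewrite ?IH.
Qed.

Lemma subterm_at_replace_parallel s pi rho r :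
  ~~ prefix pi rho -> ~~ prefix rho pi ->
  subterm_at (replace_at s pi r) rho = subterm_at s rho.
Proof.
elim: pi s rho => [s rho|i pi IH s [|k rho]]; rewrite ?prefix0s //.
case: s => [//|f a] /=; case: (insubP 'I_(ar f) k) => [j ltkj jE|//] /=.
rewrite jE [k == i]eq_sym; case: eqP => //= _ Nr Nl; exact: IH.
Qed.

Lemma subterm_at_subst sigma t pi t' : subterm_at t pi = Some t' ->
  subterm_at (subst sigma t) pi = Some (subst sigma t').
Proof.
elim: pi t => [t|i pi IH [x|f a]] //=.
  by rewrite !subterm_at_nil => -[->].
by case: insub => [j|//] /=; apply: IH.
Qed.

Lemma replace_at_subst sigma t pi r : isSome (subterm_at t pi) ->
  subst sigma (replace_at t pi r) = replace_at (subst sigma t) pi (subst sigma r).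
Proof.
elim: pi t => [t|i pi IH [x|f a]] //=; first by rewrite !replace_at_nil.
case: (insubP 'I_(ar f) i) => [j ltij jE|//] /= sN; congr Defs.Fun; apply/funext => k.
case: eqP => // kE; apply: IH; suff -> : k = j by [].
by apply: val_inj; rewrite jE.
Qed.

Lemma subst_comp sigma sigma' t :
  subst sigma (subst sigma' t) = subst (fun x => subst sigma (sigma' x)) t.
Proof. by elim: t => [//|f a IH] /=; congr Defs.Fun; apply/funext. Qed.

Lemma is_subst_comp sigma sigma' : is_subst sigma -> is_subst sigma' ->
  is_subst (fun x => subst sigma (sigma' x)).
Proof.
move=> fs fs'; rewrite /is_subst.
apply: (@sub_finite_set _ _ ([set x | sigma x <> Var ar x] `|`
  [set x | sigma' x <> Var ar x])%classic); last by rewrite finite_setU.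
move=> x /= H; case: (pselect (sigma' x = Var ar x)) => [E|]; last by right.
by left; rewrite E in H.
Qed.

Lemma subterm_at_subst_inv sigma t pi :
  isSome (subterm_at (subst sigma t) pi) ->
  fun_pos t pi \/
  exists x omega alpha, var_pos x t omega /\ pi = omega ++ alpha.
Proof.
elim: pi t => [|i pi IH] [x|f a] /=.
- by right; exists x, [::], [::].
- by left; exists f, a.
- by right; exists x, [::], (i :: pi).
case: (insubP 'I_(ar f) i) => [j ltij jE|//] /= /IH[[g [b gb]]|[x [om [al [xo ->]]]]].
  by left; exists g, b; rewrite -jE /= valK.
right; exists x, (i :: om), al; split=> //.
by rewrite /var_pos -jE /= valK.
Qed.

(** A redex at [tau] becomes a redex at [pi ++ tau] with the two substitutions composed. This lets
    the steps of a tree be copied into any term that contains an instance of its root label. *)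
Lemma prewrites_subst_ctx (R : realType) (P : ptrs R ar V) s pi sigma t
    (nu : seq (R * term)) :
  is_subst sigma -> isSome (subterm_at s pi) -> prewrites P t nu ->
  prewrites P (replace_at s pi (subst sigma t))
    [seq (p.1, replace_at s pi (subst sigma p.2)) | p <- nu].
Proof.
move=> sig sN [l [mu [sigma' [tau [rl sig' tl pnu]]]]].
exists l, mu, (fun x => subst sigma (sigma' x)), (pi ++ tau); split => //.
- exact: is_subst_comp.
- rewrite subterm_at_cat subterm_at_replace //= (subterm_at_subst sigma tl).
  by rewrite subst_comp.
- apply: (perm_trans (perm_map _ pnu)); rewrite -map_comp.
  apply/permP => b; congr (count b); apply: eq_map => p /=; congr pair.
  rewrite (replace_at_cat _ _ (subterm_at_replace _ sN)) replace_at_replace.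
  by rewrite replace_at_subst ?tl // subst_comp.
Qed.

End Positions.

(** * Non-overlapping occurrences *)

Lemma cat_eq_cat (T : Type) (a b c d : seq T) : a ++ b = c ++ d ->
  (exists2 e, c = a ++ e & b = e ++ d) \/ (exists2 e, a = c ++ e & d = e ++ b).
Proof.
elim: a c => [|x a IH] [|y c] /=.
- by move=> ->; left; exists [::].
- by move=> ->; left; exists (y :: c).
- by move=> <-; right; exists (x :: a).
- by case=> -> /IH[[e -> ->]|[e -> ->]]; [left|right]; exists e.
Qed.

Lemma leq_card_fset_inj (T U : choiceType) (A : {fset T}) (B : {fset U}) (u0 : U) :
  (#|` A| <= #|` B|)%N ->
  exists f : T -> U, {in A, forall x, f x \in B} /\ {in A &, injective f}.
Proof.
move=> leAB; exists (fun x => nth u0 (enum_fset B) (index x (enum_fset A))).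
have ltB x : x \in A -> (index x (enum_fset A) < size (enum_fset B))%N.
  by move=> xA; rewrite (leq_trans _ leAB) // index_mem.
split=> [x xA|x y xA yA /eqP]; first by rewrite mem_nth ?ltB.
rewrite nth_uniq ?ltB ?fset_uniq // => /eqP /(congr1 (nth x (enum_fset A))).
by rewrite !nth_index.
Qed.

Section Occurrences.
Context {Sigma : finType} {ar : Sigma -> nat} {V : Type}.
Local Notation term := (Defs.term ar V).
Implicit Types (s t r l : term) (x : V) (pi tau rho : seq nat)
  (sigma : V -> term).

(** The relocation map: each copy of [x] in [t] gets its own copy in [r], so that whatever hangs
    below it can be carried along. *)
Lemma var_count_inj x t r : (var_count x t <= var_count x r)%N ->
  exists io : seq nat -> seq nat,
    (forall om, var_pos x t om -> var_pos x r (io om)) /\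
    (forall om om', var_pos x t om -> var_pos x t om' -> io om = io om' ->
       om = om').
Proof.
move=> /(leq_card_fset_inj [::])[io [ioB ioI]]; exists io.
have A om : var_pos x t om -> om \in [fset pi in Pos t | `[< var_pos x t pi >]]%fset.
  move=> xo; have omP : om \in Pos t by rewrite mem_Pos xo.
  by rewrite 2!inE /=; apply/andP; split; [exact: omP|apply/asboolP].
split=> [om /A/ioB|om om' /A ? /A ?]; last exact: ioI.
by rewrite !inE /= => /andP[_ /asboolP].
Qed.

Lemma var_pos_above_fun_pos x t om al : var_pos x t om -> ~ fun_pos t (om ++ al).
Proof.
move=> xo [f [a]]; rewrite subterm_at_cat xo /=.
by case: al.
Qed.

(** Variable positions of a term form an antichain, so a position determines the variable position
    at or above it. *)
Lemma var_pos_cat_inj x y t om om' al al' :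
  var_pos x t om -> var_pos y t om' -> om ++ al = om' ++ al' ->
  om = om' /\ al = al'.
Proof.
have W x' y' (o o' e : seq nat) :
    var_pos x' t o -> var_pos y' t o' -> o' = o ++ e -> e = [::].
  move=> xo + oe; rewrite oe /var_pos subterm_at_cat xo /=.
  by case: e {oe}.
move=> xo yo' /cat_eq_cat[[e oe]|[e oe]].
- by rewrite oe (W _ _ _ _ _ xo yo' oe) ?cats0.
- by rewrite oe (W _ _ _ _ _ yo' xo oe) ?cats0.
Qed.

Lemma var_pos_inj x y t om : var_pos x t om -> var_pos y t om -> x = y.
Proof. by rewrite /var_pos => -> [->]. Qed.

Lemma overlapping_sym t p q : overlapping t p q -> overlapping t q p.
Proof. by case=> tau [ft pq]; exists tau; split=> //; case: pq; [right|left]. Qed.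

Lemma overlapping_cat t pi p q : overlapping t (pi ++ p) (pi ++ q) <-> overlapping t p q.
Proof.
split=> -[tau [ft pq]]; exists tau; split=> //; case: pq; rewrite -?catA.
- by move=> /eqP; rewrite eqseq_cat // eqxx => /eqP ->; left.
- by move=> /eqP; rewrite eqseq_cat // eqxx => /eqP ->; right.
- by move=> ->; left; rewrite catA.
- by move=> ->; right; rewrite catA.
Qed.

Lemma overlapping_comparable t p q : overlapping t p q -> prefix p q \/ prefix q p.
Proof.
by case=> tau [_ [->|->]]; [right|left]; apply: prefix_prefix.
Qed.

Lemma prefix_comparable (p q p' : seq nat) :
  prefix p (q ++ p') -> prefix p q \/ prefix q p.
Proof.
move=> /prefixP[e /esym /cat_eq_cat[[e' -> _]|[e' -> _]]].
  by left; apply: prefix_prefix.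
by right; apply: prefix_prefix.
Qed.

(** The size is exact rather than maximal: the replay tracks one set of occurrences, which need not
    stay a largest one. *)
Definition has_NO t s k := exists S, NO t s S /\ #|` S| = k.

Lemma has_NO_maxNO t s : has_NO t s (maxNO t s).
Proof.
rewrite /maxNO; apply: big_ind => [|m n Hm Hn|S /asboolP NOS].
- by exists fset0; split; [split|rewrite cardfs0] => //; exact: fsub0set.
- by rewrite /maxn; case: ifP.
- by exists S.
Qed.

Lemma has_NO_root t : ~ is_var t -> has_NO t t 1.
Proof.
move=> Nv; exists [fset [::]]%fset; split; last by rewrite cardfs1.
split.
- by apply/fsubsetP => p; rewrite inE => /eqP ->; rewrite mem_Pos subterm_at_nil.
- move=> p; rewrite inE => /eqP ->; exists (fun x => Var ar x); split.
    rewrite /is_subst (_ : [set _ | _] = set0)%classic; first exact: finite_set0.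
    by apply/seteqP; split=> // x /=.
  rewrite subterm_at_nil; congr Some; elim: {Nv} t => //= f a IH.
  by congr Defs.Fun; apply/funext.
- by move=> p q; rewrite !inE => /eqP -> /eqP ->; rewrite eqxx.
Qed.

(** [r] is quantified after [pc]: the redex is fixed when a copy of the tree starts, before it is
    known which leaf will be reached. *)
Definition replaceable t s k (pc : seq nat * (V -> term)) : Prop :=
  [/\ is_subst pc.2, subterm_at s pc.1 = Some (subst pc.2 t) &
   forall r, (forall x, (var_count x t <= var_count x r)%N) ->
   forall j, has_NO t r j ->
     has_NO t (replace_at s pc.1 (subst pc.2 r)) (k + j)].

Lemma has_NO_replace t s k : ~ is_var t -> has_NO t s k.+1 ->
  exists pc, replaceable t s k pc.
Proof.
move=> Nv [S [[/fsubsetP SP So SN] cS]].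
have ft0 : fun_pos t [::].
  case: t Nv {So SN} => [x []|f a _]; first by exists x.
  by exists f, a.
(* A position of minimal length has no other element of [S] as a prefix. *)
have [pi piS piM] :
    exists2 pi, pi \in S & forall rho, rho \in S -> prefix rho pi -> rho = pi.
  have /ex_minnP[m /hasP[pi piS /eqP <-] mM] :
      exists m, has (fun p => size p == m) (enum_fset S).
    have /fset0Pn[p pS] : S != fset0 by rewrite -cardfs_gt0 cS.
    by exists (size p); apply/hasP; exists p.
  exists pi => // rho rS /prefixP[e pE].
  have := mM (size rho); rewrite pE size_cat => H.
  have /H : has (fun p => size p == size rho) (enum_fset S) by apply/hasP; exists rho.
  rewrite -[leqRHS]addn0 leq_add2l leqn0 => /nilP eN.
  by rewrite eN cats0.
have [sigma [sig sE]] := So _ piS.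
exists (pi, sigma); split=> //= r ler j [S2 [[/fsubsetP S2P S2o S2N] cS2]].
have [io ioP] := choice (fun x => var_count_inj (ler x)).
(* [m] keeps the positions of [S] parallel to [pi] and moves the one at or below
   the variable position [om] of [t] to the copy [io x om] of [x] in [r]. *)
have [m mP] : { m : seq nat -> seq nat & forall rho, rho \in S -> rho != pi ->
   (~~ prefix pi rho /\ ~~ prefix rho pi /\ m rho = rho) \/
   exists x om al, [/\ var_pos x t om, rho = pi ++ om ++ al
                     & m rho = pi ++ io x om ++ al] }.
  apply: (choice (P := fun rho rho' => rho \in S -> rho != pi ->
   (~~ prefix pi rho /\ ~~ prefix rho pi /\ rho' = rho) \/
   exists x om al, [/\ var_pos x t om, rho = pi ++ om ++ al
                     & rho' = pi ++ io x om ++ al])) => rho.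
  case: (pselect (rho \in S /\ rho != pi)) => [[rS rN]|H]; last first.
    by exists rho => ? ?; case: H.
  case: (boolP (prefix pi rho)) => [/prefixP[tau rE]|Npr]; last first.
    exists rho => _ _; left; split=> //; split=> //.
    by apply: contraNN rN => /(piM _ rS) ->.
  have : isSome (subterm_at (subst sigma t) tau).
    by have := SP _ rS; rewrite mem_Pos rE subterm_at_cat sE.
  (* At a function symbol of [t], [rho] would overlap [pi], so only the variable case remains. *)
  move=> /subterm_at_subst_inv[ft|[x [om [al [xo tE]]]]].
    by case: (SN _ _ rS piS rN); exists tau; split=> //; left.
  by exists (pi ++ io x om ++ al) => _ _; right; exists x, om, al; rewrite rE tE.
pose s' := replace_at s pi (subst sigma r).
have s'E tau : subterm_at s' (pi ++ tau) = subterm_at (subst sigma r) tau.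
  by rewrite subterm_at_cat subterm_at_replace ?sE.
have Npar (p q : seq nat) :
    ~~ prefix pi p -> ~~ prefix p pi -> ~ overlapping t p (pi ++ q).
  move=> N1 N2 /overlapping_comparable.
  case=> [/prefix_comparable|/(prefix_trans (prefix_prefix _ _))].
    by case; apply/negP.
  exact/negP.
(* Two positions moved below variables can overlap only below the same copy in [r]; as [io x] is
   injective, [p] and [q] then overlapped already. *)
have N1 p q : p \in S -> p != pi -> q \in S -> q != pi -> p != q ->
    ~ overlapping t (m p) (m q).
  move=> pS pN qS qN pq.
  case: (mP _ pS pN) => [[p1 [p2 ->]]|[x [om [al [xo pE ->]]]]];
    case: (mP _ qS qN) => [[q1 [q2 ->]]|[y [om' [al' [yo qE ->]]]]].
  - exact: SN.
  - exact: Npar.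
  - by move=> /overlapping_sym; exact: Npar.
  - have cE : om = om' -> overlapping t p q -> False by move=> _; exact: SN.
    have xo' := (ioP x).1 _ xo; have yo' := (ioP y).1 _ yo.
    have dis e e' : io x om ++ e = io y om' ++ e' -> om = om'.
      move=> /(var_pos_cat_inj xo' yo')[E _].
      have xy : x = y by apply: (@var_pos_inj _ _ r (io x om)) => //; rewrite E.
      by move: E yo; rewrite -xy => E yo; exact: (ioP x).2 E.
    move=> /overlapping_cat ov.
    have oE : om = om'.
      by case: ov => tau [_ []]; rewrite -catA; [|move/esym]; apply: dis.
    apply: (cE oE); rewrite pE qE; apply/overlapping_cat.
    move: ov; rewrite -oE; have -> : x = y.
      by apply: (@var_pos_inj _ _ t om) => //; rewrite oE.
    by move=> /overlapping_cat ?; apply/overlapping_cat.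
have funS2 nu tau : nu \in S2 -> fun_pos t tau -> fun_pos r (nu ++ tau).
  move=> /S2o[d [_ nE]] [f [a fE]]; exists f, (fun i => subst d (a i)).
  by rewrite subterm_at_cat nE /= (subterm_at_subst _ fE).
(* The function symbols of [t] matched at [nu] are function symbols of [r], whereas a position moved
   along [io x] is at or below a variable of [r]. *)
have N2 p nu : p \in S -> p != pi -> nu \in S2 -> ~ overlapping t (m p) (pi ++ nu).
  move=> pS pN nS.
  case: (mP _ pS pN) => [[p1 [p2 ->]]|[x [om [al [xo pE ->]]]]]; first exact: Npar.
  move=> /overlapping_cat[tau [ft]]; have xo' := (ioP x).1 _ xo.
  case=> E.
    by have := funS2 _ _ nS ft; rewrite -E; apply: (var_pos_above_fun_pos xo').
  have := funS2 _ _ nS ft0; rewrite cats0 E -catA; exact: (var_pos_above_fun_pos xo').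
have N3 nu nu' : nu \in S2 -> nu' \in S2 -> nu != nu' ->
    ~ overlapping t (pi ++ nu) (pi ++ nu').
  by move=> ? ? ? /overlapping_cat; exact: S2N.
(* Overlap is reflexive because [t] is not a variable. Hence the non-overlap facts also yield
   injectivity of [m] and disjointness of [A] and [B]. *)
have orefl p : overlapping t p p by exists [::]; split=> //; left; rewrite cats0.
pose A := [fset m rho | rho in (S `\ pi)%fset]%fset.
pose B := [fset pi ++ nu | nu in S2]%fset.
have inA p : p \in A -> exists2 rho, rho \in S /\ rho != pi & p = m rho.
  by move=> /imfsetP[rho /= ]; rewrite !inE => /andP[? ?] ->; exists rho.
have inB p : p \in B -> exists2 nu, nu \in S2 & p = pi ++ nu.
  by move=> /imfsetP[rho /= ? ->]; exists rho.
have occA rho : rho \in S -> rho != pi -> subterm_at s' (m rho) = subterm_at s rho.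
  move=> rS rN; case: (mP _ rS rN) => [[p1 [p2 ->]]|[x [om [al [xo pE ->]]]]].
    exact: subterm_at_replace_parallel.
  rewrite s'E pE !subterm_at_cat (subterm_at_subst _ ((ioP x).1 _ xo)) sE /=.
  by rewrite subterm_at_cat (subterm_at_subst _ xo).
have occB nu : nu \in S2 -> occurs_at t s' (pi ++ nu).
  move=> /S2o[d [fd nE]]; exists (fun x => subst sigma (d x)).
  by split; [exact: is_subst_comp|rewrite s'E (subterm_at_subst _ nE) subst_comp].
exists (A `|` B)%fset; split; first split.
- apply/fsubsetP => p; rewrite inE => /orP[/inA[rho [rS rN] ->]|/inB[nu nS ->]].
    by rewrite mem_Pos occA // -mem_Pos SP.
  by rewrite mem_Pos; have [d [_ ->]] := occB _ nS.
- move=> p; rewrite inE => /orP[/inA[rho [rS rN] ->]|/inB[nu nS ->]]; last exact: occB.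
  by have [d [fd E]] := So _ rS; exists d; rewrite occA.
- move=> p q; rewrite !inE.
  move=> /orP[/inA[rho [rS rN] ->]|/inB[nu nS ->]] /orP[/inA[rho' [rS' rN'] ->]|/inB[nu' nS' ->]] Npq.
  + by apply: N1 => //; apply: contraNneq Npq => ->.
  + exact: N2.
  + by move=> /overlapping_sym; exact: N2.
  + by apply: N3 => //; apply: contraNneq Npq => ->.
- rewrite cardfsU (_ : A `&` B = fset0)%fset; last first.
    apply/eqP; rewrite -fsubset0; apply/fsubsetP => p; rewrite !inE.
    move=> /andP[/inA[rho [rS rN] ->] /inB[nu nS E]].
    by case: (N2 _ _ rS rN nS); rewrite -E.
  have -> : #|` A| = #|` (S `\ pi)%fset|.
    apply: card_in_imfset => p q; rewrite !in_fsetD1.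
    move=> /andP[pN pS] /andP[qN qS] E.
    by apply/eqP/negPn/negP => pq; case: (N1 _ _ pS pN qS qN pq); rewrite E.
  have -> : #|` B| = #|` S2|.
    by apply: card_in_imfset => p q _ _ /eqP; rewrite eqseq_cat // eqxx => /eqP.
  by have := cardfsD1 pi S; rewrite piS cS cS2 add1n cardfs0 subn0 => -[->].
Qed.

End Occurrences.

(** * Level sums of a rewrite sequence tree *)

Section Levels.
Context {R : realType} {Sigma : finType} {ar : Sigma -> nat} {V : Type}.
Context {P : ptrs R ar V}.

Lemma prewrites_sum s (nu : seq (R * Defs.term ar V)) :
  prewrites P s nu -> \sum_(p <- nu) p.1 = 1.
Proof.
move=> [l [mu [sigma [pi [rl _ _ pnu]]]]].
have [_ _ <- _] := rules_valid rl.
by rewrite (perm_big _ pnu) /= big_map.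
Qed.

Lemma prewrites_nonvar x (nu : seq (R * Defs.term ar V)) :
  ~ prewrites P (Var ar x) nu.
Proof.
move=> [l [mu [sigma [pi [rl _ sl _]]]]].
have [Nv _ _ _] := rules_valid rl.
case: pi sl => [|//] /= [lE]; apply: Nv.
by case: l lE {rl} => [y _|//]; exists y.
Qed.

Section Tree.
Context (T : rst P).

Definition children_seq v k : seq (R * Defs.term ar V) :=
  [seq (prob T (rcons v i) / prob T v, label T (rcons v i)) | i <- iota 0 k].

(** Leaves and addresses outside the tree both get 0, so that the degree is total and being a leaf
    becomes a boolean test on nodes. *)
Lemma deg_subproof v : exists k : nat,
  (forall i, node T (rcons v i) <-> (i < k)%N) /\
  ((0 < k)%N -> prewrites P (label T v) (children_seq v k)).
Proof.
case: (pselect (node T v)) => [nv|Nv]; last first.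
  by exists 0%N; split=> // i; split=> // /rst_prefix.
case: (rst_children nv) => [Nc|[k [kP pk]]]; last by exists k; split.
by exists 0%N; split=> // i; split=> // /Nc.
Qed.

Definition deg v := projT1 (cid (deg_subproof v)).

Lemma node_rcons v i : node T (rcons v i) <-> (i < deg v)%N.
Proof. by rewrite /deg; case: cid => k [H _] /=. Qed.

Lemma deg_prewrites v : (0 < deg v)%N ->
  prewrites P (label T v) (children_seq v (deg v)).
Proof. by rewrite /deg; case: cid => k [_ H] /=. Qed.

Lemma leafE v : leaf T v <-> node T v /\ deg v = 0%N.
Proof.
split=> -[nv H]; split=> //.
  by apply/eqP; rewrite -leqn0 leqNgt; apply/negP => /(node_rcons v 0).2 /H.
by move=> i /node_rcons; rewrite H.
Qed.

Lemma prob_gt0 v : node T v -> 0 < prob T v.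
Proof. by move=> /rst_prob/andP[]. Qed.

Lemma prob_ge0 v : node T v -> 0 <= prob T v.
Proof. by move=> /prob_gt0/ltW. Qed.

Lemma sum_prob_children v : node T v -> (0 < deg v)%N ->
  \sum_(i <- iota 0 (deg v)) prob T (rcons v i) = prob T v.
Proof.
move=> nv dv; have := prewrites_sum (deg_prewrites dv).
rewrite /children_seq big_map /= -mulr_suml => /(congr1 ( *%R^~ (prob T v))).
by rewrite divfK ?mul1r // gt_eqF // prob_gt0.
Qed.

(** Branching is finite, so each depth is a finite list and sums over leaves become series of finite
    sums. *)
Fixpoint level n : seq (seq nat) :=
  if n is n'.+1 then
    flatten [seq [seq rcons v i | i <- iota 0 (deg v)] | v <- level n']
  else [:: [::]].

Lemma mem_level n v : (v \in level n) <-> node T v /\ size v = n.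
Proof.
elim: n v => [|n IH] v /=.
  rewrite inE; split=> [/eqP ->|[_ /size0nil ->]]; last by [].
  by split=> //; exact: rst_root.
split=> [/flatten_mapP[w /IH[nw sw] /mapP[i]]|].
  by rewrite mem_iota add0n => /node_rcons ? ->; rewrite size_rcons sw.
case: (lastP v) => [[]//|w i [nv]]; rewrite size_rcons => -[sw].
apply/flatten_mapP; exists w; first by apply/IH; split=> //; exact: rst_prefix nv.
by apply/mapP; exists i; rewrite // mem_iota add0n; apply/node_rcons.
Qed.

Lemma uniq_level n : uniq (level n).
Proof.
elim: n => [//|n IH] /=.
elim: (level n) IH => [//|v s IHs] /= /andP[vs us].
rewrite cat_uniq IHs // andbT; apply/andP; split.
  by rewrite map_inj_uniq ?iota_uniq // => i j /rcons_inj[].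
apply/hasPn => w /flatten_mapP[u us' /mapP[i _ ->]].
apply/negP => /mapP[j _] /rcons_inj[uv _].
by rewrite -uv us' in vs.
Qed.

Lemma sum_level_succ n (F : seq nat -> R) :
  \sum_(v <- level n.+1) F v =
  \sum_(v <- level n | deg v != 0%N) \sum_(i <- iota 0 (deg v)) F (rcons v i).
Proof.
rewrite /= big_flatten big_map [RHS]big_mkcond; apply: eq_bigr => v _.
by rewrite big_map; case: eqP => //= ->; rewrite big_nil.
Qed.

(** The probability of reaching depth [n]. By [massS], [mass n.+1] is the probability of not having
    stopped by depth [n]. *)
Definition mass n : R := \sum_(v <- level n) prob T v.

Definition leaf_sum (g : seq nat -> R) n : R :=
  \sum_(v <- level n | deg v == 0%N) g v.

Lemma mass_ge0 n : 0 <= mass n.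
Proof.
rewrite /mass big_seq; apply: sumr_ge0 => v /mem_level[nv _]; exact: prob_ge0.
Qed.

Lemma leaf_sum_ge0 g n : (forall v, leaf T v -> 0 <= g v) -> 0 <= leaf_sum g n.
Proof.
move=> g0; rewrite /leaf_sum big_seq_cond; apply: sumr_ge0 => v.
by move=> /andP[/mem_level[nv _] /eqP dv]; apply/g0/leafE.
Qed.

Lemma mass0 : mass 0 = 1.
Proof. by rewrite /mass big_seq1 rst_prob_root. Qed.

Lemma massS n : mass n.+1 = mass n - leaf_sum (prob T) n.
Proof.
rewrite /mass sum_level_succ [X in _ = X - _](bigID (fun v => deg v == 0%N)) /=.
rewrite /leaf_sum addrAC subrr add0r big_seq_cond [RHS]big_seq_cond; apply: eq_bigr => v.
by move=> /andP[/mem_level[nv _] dv]; rewrite sum_prob_children // lt0n.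
Qed.

Lemma mass_leaf_sum n : mass n + \sum_(k < n) leaf_sum (prob T) k = 1.
Proof.
elim: n => [|n IH]; first by rewrite big_ord0 mass0 addr0.
by rewrite massS big_ord_recr /= addrACA addNr addr0.
Qed.

(** The invariant adds the mass already lost to leaves to the level sum of [H]. Going one level down
    costs at most [d] per unit of inner mass, and [1 <= H] at leaves pays for the mass that stops
    there. *)
Lemma potential_bound (H : seq nat -> R) (d : R) :
  (forall v, node T v -> 0 <= H v) ->
  (forall v, leaf T v -> 1 <= H v) ->
  (forall v, node T v -> (0 < deg v)%N ->
     \sum_(i <- iota 0 (deg v)) prob T (rcons v i) * H (rcons v i)
       <= prob T v * (H v + d)) ->
  forall n, 1 <= H [::] + mass n + d * \sum_(k < n) mass k.+1.
Proof.
move=> H0 Hl Hs n.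
suff : \sum_(v <- level n) prob T v * H v + \sum_(k < n) leaf_sum (prob T) k
    <= H [::] + d * \sum_(k < n) mass k.+1.
  have : 0 <= \sum_(v <- level n) prob T v * H v.
    rewrite big_seq; apply: sumr_ge0 => v /mem_level[nv _].
    by rewrite mulr_ge0 ?prob_ge0 ?H0.
  by have := mass_leaf_sum n; lra.
elim: n => [|n IH].
  by rewrite !big_ord0 big_seq1 rst_prob_root mul1r mulr0 !addr0.
rewrite sum_level_succ !big_ord_recr /= mulrDr.
suff : \sum_(v <- level n | deg v != 0%N)
     \sum_(i <- iota 0 (deg v)) prob T (rcons v i) * H (rcons v i)
   + leaf_sum (prob T) n <= \sum_(v <- level n) prob T v * H v + d * mass n.+1.
  by move: IH; lra.
rewrite [X in _ <= X + _](bigID (fun v => deg v != 0%N)) /= /mass sum_level_succ.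
rewrite mulr_sumr addrAC -big_split /=; apply: lerD.
  rewrite big_seq_cond [leRHS]big_seq_cond; apply: ler_sum => v.
  move=> /andP[/mem_level[nv _] dv]; rewrite sum_prob_children ?lt0n //.
  by rewrite [d * _]mulrC -mulrDr Hs ?lt0n.
rewrite /leaf_sum big_seq_cond [leRHS]big_seq_cond.
under [leRHS]eq_bigl do rewrite negbK.
apply: ler_sum => v /andP[/mem_level[nv _] /eqP dv].
by rewrite ler_peMr ?prob_ge0 // Hl //; apply/leafE.
Qed.

Lemma esum_leafE (g : seq nat -> R) : (forall v, leaf T v -> 0 <= g v) ->
  (\esum_(v in leaf T) (g v)%:E = \sum_(0 <= n <oo) (leaf_sum g n)%:E)%E.
Proof.
move=> g0; pose J n := [set` [seq v <- level n | deg v == 0%N]]%classic.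
have JP n v : J n v -> leaf T v /\ size v = n.
  by rewrite /J /= mem_filter => /andP[/eqP dv /mem_level[nv sv]]; split=> //; apply/leafE.
have -> : leaf T = (\bigcup_(n in setT) J n)%classic.
  apply/seteqP; split=> [v lv|v [n _ /JP[]//]]; exists (size v) => //.
  have [nv dv] := (leafE v).1 lv.
  by rewrite /J /= mem_filter dv eqxx; apply/mem_level.
rewrite esum_bigcup; last first.
- by move=> v [n _ /JP[/g0]]; rewrite lee_fin.
- by move=> i j _ _ [v [/JP[_ <-] /JP[_ <-]]].
rewrite nneseries_esumT => [|n]; last by rewrite lee_fin leaf_sum_ge0.
apply: eq_esum => n _.
rewrite esum_fset; last first.
- by move=> v /set_mem/JP[/g0]; rewrite lee_fin.
- exact: finite_seq.
by rewrite -fsbig_seq ?filter_uniq ?uniq_level // /leaf_sum -sumEFin big_filter.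
Qed.

Lemma leaf_sum_le_esum (g : seq nat -> R) n : (forall v, leaf T v -> 0 <= g v) ->
  ((\sum_(k < n) leaf_sum g k)%:E <= \esum_(v in leaf T) (g v)%:E)%E.
Proof.
move=> g0; rewrite esum_leafE // -(big_mkord xpredT (leaf_sum g)) -sumEFin.
by apply: nneseries_lim_ge => k _ _; rewrite lee_fin leaf_sum_ge0.
Qed.

Lemma esum_leaf_le (g : seq nat -> R) (M : \bar R) :
  (forall v, leaf T v -> 0 <= g v) ->
  (forall n, (\sum_(k < n) leaf_sum g k)%:E <= M)%E ->
  (\esum_(v in leaf T) (g v)%:E <= M)%E.
Proof.
move=> g0 HM; rewrite esum_leafE //; apply: lime_le.
  by apply: is_cvg_nneseries => n _ _; rewrite lee_fin leaf_sum_ge0.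
by apply: nearW => n; rewrite sumEFin big_mkord.
Qed.

Lemma leaf_prob_ge0 v : leaf T v -> 0 <= prob T v.
Proof. by case=> nv _; exact: prob_ge0. Qed.

Lemma leaf_mass_le1 : (leaf_mass T <= 1)%E.
Proof.
apply: esum_leaf_le => [|n]; first exact: leaf_prob_ge0.
by rewrite lee_fin; have := mass_leaf_sum n; have := mass_ge0 n; lra.
Qed.

Lemma mass_cvg0 (e : R) : (1 <= leaf_mass T)%E -> 0 < e ->
  exists n, mass n < e.
Proof.
move=> m1 e0; apply: contrapT => Ne; have : (leaf_mass T <= (1 - e)%:E)%E.
  apply: esum_leaf_le => [|n]; first exact: leaf_prob_ge0.
  rewrite lee_fin; have := mass_leaf_sum n; have : e <= mass n.
    by rewrite leNgt; apply/negP => ?; apply: Ne; exists n.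
  lra.
by move=> /(le_trans m1); rewrite lee_fin; lra.
Qed.

Lemma mass_decreasing m n : (m <= n)%N -> mass n <= mass m.
Proof.
elim: n => [|n IH]; first by rewrite leqn0 => /eqP ->.
rewrite leq_eqVlt => /predU1P[-> //|/IH]; apply: le_trans.
by rewrite massS lerBlDr lerDl leaf_sum_ge0 //; exact: leaf_prob_ge0.
Qed.

(** Tail-sum form of the expected depth: [mass k.+1] is the probability of a depth above [k]. The
    boundary term of Abel summation accounts for the extra 1 in the bound. *)
Lemma sum_mass_bounded : (edl T < +oo)%E ->
  exists D : R, 0 <= D /\ forall n, \sum_(k < n) mass k.+1 <= D.
Proof.
rewrite /edl; case: (ltP (leaf_mass T) 1%E) => [_|m1 Dfin]; first by rewrite ltxx.
pose g v : R := (size v)%:R * prob T v.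
have g0 v : leaf T v -> 0 <= g v by move=> /leaf_prob_ge0 ?; rewrite mulr_ge0.
have gE n : leaf_sum g n = n%:R * leaf_sum (prob T) n.
  rewrite /leaf_sum mulr_sumr big_seq_cond [RHS]big_seq_cond; apply: eq_bigr => v.
  by rewrite /g => /andP[/mem_level[_ ->]].
have E0 : (0 <= \esum_(v in leaf T) (g v)%:E)%E by apply: esum_ge0 => v /g0.
have Efin : \esum_(v in leaf T) (g v)%:E \is a fin_num.
  by rewrite ge0_fin_numE; [exact: Dfin|exact: E0].
set E := (esum _ _) in E0 Efin Dfin.
have sE n : \sum_(k < n) leaf_sum g k <= fine E.
  by rewrite -lee_fin fineK //; exact: leaf_sum_le_esum.
exists (fine E + 1); split=> [|n]; first by rewrite addr_ge0 ?fine_ge0.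
have abel m : \sum_(k < m) mass k.+1 = \sum_(k < m) leaf_sum g k + m%:R * mass m.
  elim: m => [|m IH]; first by rewrite !big_ord0 mul0r addr0.
  rewrite !big_ord_recr /= IH gE massS -[m.+1]addn1 natrD; ring.
(* The boundary term at [n] is traded for [n%:R * mass N] at a later level [N], where the mass is
   small enough to make it at most 1. *)
have [N0 mN0] : exists N, mass N < n.+1%:R^-1 by apply: mass_cvg0; rewrite ?invr_gt0.
pose N := maxn n N0.
have mN : n%:R * mass N <= 1.
  have mN : mass N <= n.+1%:R^-1.
    by apply: le_trans (ltW mN0); apply: mass_decreasing; rewrite leq_maxr.
  apply: le_trans (_ : n.+1%:R * n.+1%:R^-1 <= 1); last by rewrite divff.
  by apply: ler_pM; rewrite ?mass_ge0 // ler_nat.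
(* With the factor [n] kept fixed the expression grows with the level, since a leaf at depth
   [m >= n] contributes [m] times its probability. *)
have mono m : (n <= m)%N ->
    \sum_(k < n) leaf_sum g k + n%:R * mass n <= \sum_(k < m) leaf_sum g k + n%:R * mass m.
  elim: m => [|m IH]; first by rewrite leqn0 => /eqP ->.
  rewrite leq_eqVlt => /predU1P[-> //|]; rewrite ltnS => nm.
  apply: le_trans (IH nm) _; rewrite big_ord_recr /= gE massS.
  have L0 : 0 <= leaf_sum (prob T) m by apply: leaf_sum_ge0; exact: leaf_prob_ge0.
  have : (n%:R : R) * leaf_sum (prob T) m <= m%:R * leaf_sum (prob T) m.
    by rewrite ler_wpM2r // ler_nat.
  lra.
rewrite abel; apply: le_trans (mono N (leq_maxl _ _)) _.
by apply: lerD.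
Qed.

End Tree.

End Levels.

(** The first-order gain [n%:R * e] minus a quadratic error. Averaged over finitely many leaves, the
    first moment dominates for small [e]. *)
Lemma one_sub_exp_ge (R : realDomainType) (e : R) n : 0 <= e <= 1 ->
  n%:R * e - n%:R ^+ 2 * e ^+ 2 <= 1 - (1 - e) ^+ n.
Proof.
move=> /andP[e0 e1]; rewrite -subr_ge0; elim: n => [|n IH].
  by rewrite expr0 subrr mul0r expr0n /= mul0r !subr0.
rewrite exprS; have n0 : (0 : R) <= n%:R by [].
rewrite -natr1; move: IH n0; set x := n%:R; set y := _ ^+ n => IH n0.
have : 0 <= (1 - e) * (1 - y - (x * e - x ^+ 2 * e ^+ 2)).
  by rewrite mulr_ge0 // subr_ge0.
have : 0 <= x * e ^+ 2 by rewrite mulr_ge0 // exprn_ge0.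
have : 0 <= e ^+ 2 by rewrite exprn_ge0.
have : 0 <= x ^+ 2 * e ^+ 3 by rewrite mulr_ge0 // exprn_ge0.
nra.
Qed.

(** * Leaf weights below a node and the choice of [th] *)

Section LeafBelow.
Context {R : realType} {Sigma : finType} {ar : Sigma -> nat} {V : Type}.
Context {P : ptrs R ar V} (T : rst P).

Lemma node_cat v w : node T (v ++ w) -> node T v.
Proof.
elim/last_ind: w => [|w i IH]; first by rewrite cats0.
by rewrite -rcons_cat => /rst_prefix.
Qed.

Lemma prefix_rcons_inj (u w : seq nat) i j :
  prefix (rcons u i) w -> prefix (rcons u j) w -> i = j.
Proof.
move=> /prefixP[e ->] /prefixP[e' /eqP].
by rewrite !cat_rcons eqseq_cat // => /andP[_ /eqP[]].
Qed.

Section Weight.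
Context (g : seq nat -> R) (g01 : forall v, leaf T v -> 0 <= g v <= prob T v).

(** Under [g01] the sum is at most 1, so [fine] loses nothing. *)
Definition leaf_below u : R :=
  fine (\esum_(v in leaf T) (g v * (prefix u v)%:R)%:E)%E.

Lemma leaf_weight_ge0 u v : leaf T v -> 0 <= g v * (prefix u v)%:R.
Proof. by move=> /g01/andP[? _]; rewrite mulr_ge0. Qed.

Lemma esum_below_fin u :
  (\esum_(v in leaf T) (g v * (prefix u v)%:R)%:E)%E \is a fin_num.
Proof.
rewrite ge0_fin_numE; last by apply: esum_ge0 => v lv; rewrite lee_fin leaf_weight_ge0.
apply: le_lt_trans (ltry (1 : R)); apply: le_trans (leaf_mass_le1 T).
apply: le_esum => v lv; rewrite lee_fin; have /andP[g0 g1] := g01 lv.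
by apply: le_trans g1; case: prefix; rewrite ?mulr1 ?mulr0.
Qed.

Lemma leaf_below_ge0 u : 0 <= leaf_below u.
Proof. by apply/fine_ge0/esum_ge0 => v lv; rewrite lee_fin leaf_weight_ge0. Qed.

Lemma leaf_below_leaf v : leaf T v -> g v <= leaf_below v.
Proof.
move=> lv; rewrite -lee_fin fineK ?esum_below_fin //; apply: esum_ge.
exists [set v]%classic; first by split; [exact: finite_set1|move=> w ->].
by rewrite fsbig_set1 lee_fin prefix_refl mulr1.
Qed.

(** The subtrees of the children are disjoint: a leaf extends at most one [rcons u i]. *)
Lemma sum_leaf_below u k :
  \sum_(i <- iota 0 k) leaf_below (rcons u i) <= leaf_below u.
Proof.
rewrite -lee_fin -sumEFin fineK ?esum_below_fin //.
under eq_bigr do rewrite fineK ?esum_below_fin //.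
rewrite -esum_sum; last by move=> v i lv _; rewrite lee_fin leaf_weight_ge0.
apply: le_esum => v lv; rewrite sumEFin lee_fin -mulr_sumr.
have /andP[g0 _] := g01 lv; apply: ler_wpM2l => //.
have [/hasP[i ik iv]|] := boolP (has (fun i => prefix (rcons u i) v) (iota 0 k)).
  rewrite (bigD1_seq i) ?iota_uniq //= iv big1 ?addr0.
    suff -> : prefix u v by [].
    by apply: prefix_trans iv; rewrite -cats1 prefix_prefix.
  move=> j ji; case: (boolP (prefix (rcons u j) v)) => // jv.
  by rewrite (prefix_rcons_inj iv jv) eqxx in ji.
move=> /hasPn H; rewrite big_seq big1 // => i /H.
by move=> /negbTE ->.
Qed.

Lemma leaf_below_root_le (M : R) :
  (forall n, \sum_(k < n) leaf_sum T g k <= M) -> leaf_below [::] <= M.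
Proof.
move=> HM; rewrite -lee_fin fineK ?esum_below_fin //.
under eq_esum do rewrite prefix0s mulr1.
apply: esum_leaf_le => [v /g01/andP[]//|n]; first by rewrite lee_fin.
Qed.

End Weight.

(** At [th = 1] the sum is the leaf mass, at most 1, and its slope is an expectation above [c], so
    some [th] close to 1 works. Since this expectation and the second moment may be infinite, the
    gain is estimated on finitely many levels. *)
Lemma exists_theta (xi : seq nat -> nat) (c : R) :
  (c%:E < \esum_(v in leaf T) (prob T v * (xi v)%:R)%:E)%E ->
  exists th : R, [/\ 0 < th, th < 1 &
    leaf_below (fun v => prob T v * th ^+ xi v) [::] <= 1 - c * (1 - th)].
Proof.
move=> cE; pose a n := \sum_(k < n) leaf_sum T (fun v => prob T v * (xi v)%:R) k.
have [n can] : exists n, c < a n.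
  apply: contrapT => Ne; move: cE; apply/negP; rewrite -leNgt.
  apply: esum_leaf_le => [v lv|n]; first by rewrite mulr_ge0 ?leaf_prob_ge0.
  by rewrite lee_fin leNgt; apply/negP => H; apply: Ne; exists n.
pose q v : R := prob T v * (xi v)%:R ^+ 2.
pose Q := \sum_(k < n) leaf_sum T q k.
have Q0 : 0 <= Q.
  apply: sumr_ge0 => k _; apply: leaf_sum_ge0 => v lv.
  by rewrite mulr_ge0 ?leaf_prob_ge0 ?exprn_ge0.
pose b := a n - c; have b0 : 0 < b by rewrite subr_gt0.
(* The size of [d] gives both [e < 1] and [e * Q <= b]; the latter keeps the quadratic error below
   the excess [b] of the truncated expectation over [c]. *)
pose d := Q + 1 + 2%:R * b; have d0 : 0 < d by rewrite /d; lra.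
pose e := b / d.
have e0 : 0 < e by rewrite divr_gt0.
have ed : e * d = b by rewrite divfK // gt_eqF.
have e1 : e < 1 by rewrite -(ltr_pM2r d0) ed mul1r /d; lra.
have eQ : e * Q <= b.
  by rewrite -ed ler_pM2l // /d; lra.
exists (1 - e); split; [by lra|by lra|].
have th01 k : 0 <= (1 - e) ^+ k <= 1 by rewrite exprn_ge0 ?exprn_ile1 //; lra.
pose h v : R := prob T v * (1 - (1 - e) ^+ xi v).
have h0 v : leaf T v -> 0 <= h v.
  by move=> lv; rewrite mulr_ge0 ?leaf_prob_ge0 // subr_ge0; case/andP: (th01 (xi v)).
apply: leaf_below_root_le => [v lv|m].
  have /andP[t0 t1] := th01 (xi v).
  by rewrite mulr_ge0 ?leaf_prob_ge0 //= ler_piMr ?leaf_prob_ge0.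
have gE k : leaf_sum T (fun v => prob T v * (1 - e) ^+ xi v) k
    = leaf_sum T (prob T) k - leaf_sum T h k.
  rewrite /leaf_sum -sumrB; apply: eq_bigr => v _; rewrite /h; ring.
have hn : c * e <= \sum_(k < n) leaf_sum T h k.
  apply: (@le_trans _ _ (e * a n - e ^+ 2 * Q)).
    rewrite -subr_ge0; have -> : e * a n - e ^+ 2 * Q - c * e = e * (b - e * Q).
      by rewrite /b; ring.
    by rewrite mulr_ge0 ?subr_ge0 // ltW.
  rewrite /a /Q !mulr_sumr -sumrB; apply: ler_sum => k _.
  rewrite /leaf_sum !mulr_sumr -sumrB big_seq_cond [leRHS]big_seq_cond.
  apply: ler_sum => v /andP[/mem_level[nv _] /eqP dv].
  have lv : leaf T v by apply/leafE.
  have := @one_sub_exp_ge _ e (xi v); rewrite (ltW e0) (ltW e1) => /(_ isT) H.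
  apply: le_trans (_ : prob T v * ((xi v)%:R * e - (xi v)%:R ^+ 2 * e ^+ 2) <= _).
    by rewrite le_eqVlt; apply/orP; left; apply/eqP; rewrite /q; ring.
  by rewrite ler_wpM2l // leaf_prob_ge0.
have g0 k : 0 <= leaf_sum T (fun v => prob T v * (1 - e) ^+ xi v) k.
  apply: leaf_sum_ge0 => v lv; rewrite mulr_ge0 ?leaf_prob_ge0 //.
  by case/andP: (th01 (xi v)).
have mono (F : nat -> R) i j : (forall k, 0 <= F k) -> (i <= j)%N ->
    \sum_(k < i) F k <= \sum_(k < j) F k.
  move=> F0; elim: j => [|j IH]; first by rewrite leqn0 => /eqP ->.
  rewrite leq_eqVlt => /predU1P[-> //|/IH ij].
  by rewrite big_ord_recr /=; apply: le_trans ij _; rewrite lerDl.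
(* Passing to [maxn m n] brings in the first [n] levels, where the gain [c * e] is secured. *)
apply: le_trans (mono _ _ _ g0 (leq_maxl m n)) _.
under eq_bigr do rewrite gE; rewrite sumrB.
have := mono _ _ _ (fun k => @leaf_sum_ge0 _ _ _ _ _ T h k h0) (leq_maxr m n).
have := mass_leaf_sum T (maxn m n); have := mass_ge0 T (maxn m n).
have -> : c * (1 - (1 - e)) = c * e by ring.
lra.
Qed.

End LeafBelow.

(** * The replayed tree *)

Section Replay.
Context {R : realType} {Sigma : finType} {ar : Sigma -> nat} {V : Type}.
Context {P : ptrs R ar V} (T : rst P).
Local Notation term := (Defs.term ar V).
Local Notation t := (label T [::]).
Context (redex : term -> nat -> seq nat * (V -> term)).

(* [sterm] and its number [scount] of non-overlapping occurrences of [t] are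
   those at the start of the current copy of [T], and [saddr] is the address
   reached inside that copy; the term reached is [slabel]. *)
Record state := State {
  sterm : term; scount : nat; saddr : seq nat; sprob : R; svalid : bool }.

Definition slabel x : term :=
  if scount x is k.+1 then
    let pc := redex (sterm x) k in
    replace_at (sterm x) pc.1 (subst pc.2 (label T (saddr x)))
  else sterm x.

(** On reaching a leaf of [T] the next copy starts at once, so the address stored in a valid state
    is always that of an inner node. *)
Definition step x i : state :=
  let u := rcons (saddr x) i in
  let p := sprob x * (prob T u / prob T (saddr x)) in
  let b := [&& svalid x, (0 < scount x)%N & (i < deg T (saddr x))%N] in
  if deg T u == 0%N then
    let pc := redex (sterm x) (scount x).-1 in
    State (replace_at (sterm x) pc.1 (subst pc.2 (label T u)))
      ((scount x).-1 + maxNO t (label T u)) [::] p b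
  else State (sterm x) (scount x) u p b.

Definition replay w : state := foldl step (State t 1 [::] 1 true) w.

Lemma replay_rcons w i : replay (rcons w i) = step (replay w) i.
Proof. by rewrite /replay foldl_rcons. Qed.

Context (t_nonvar : ~ is_var t) (root_deg : (0 < deg T [::])%N).
Context (redexP : forall s k, has_NO t s k.+1 -> replaceable t s k (redex s k)).
Context (nvd : non_variable_decreasing T).

Definition sinv x : Prop :=
  [/\ has_NO t (sterm x) (scount x), node T (saddr x), (0 < deg T (saddr x))%N &
      0 < sprob x].

Lemma step_inv x i : (svalid x -> sinv x) -> svalid (step x i) -> sinv (step x i).
Proof.
rewrite /step; set u := rcons _ _; case: ifP => du /= + /and3P[vx k0 id].
  move=> /(_ vx)[+ nx dx px]; case: (scount x) k0 => // k _ Hx.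
  have nu : node T u by apply/node_rcons.
  split=> //=; do ?exact: rst_root.
    have [_ _] := redexP Hx; apply; last exact: has_NO_maxNO.
    by apply: nvd; apply/leafE; split=> //; apply/eqP.
  by rewrite mulr_gt0 // divr_gt0 // prob_gt0.
move=> /(_ vx)[Hx nx dx px]; have nu : node T u by apply/node_rcons.
split=> //=; first by rewrite lt0n du.
by rewrite mulr_gt0 // divr_gt0 // prob_gt0.
Qed.

Lemma replay_inv w : svalid (replay w) -> sinv (replay w).
Proof.
elim/last_ind: w => [_|w i IH].
  by split=> //=; [exact: has_NO_root|exact: rst_root].
by rewrite replay_rcons; exact: step_inv.
Qed.

(** Restarting leaves the term unchanged: the root of the new copy is labeled [t], whose instance
    already stands at the chosen redex. *)
Lemma slabel_start s k : has_NO t s k -> forall p b,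
  slabel (State s k [::] p b) = s.
Proof.
by case: k => [//|k] /redexP[_ sE _] p b; rewrite /slabel /= replace_at_subterm.
Qed.

Lemma slabel_step x i : sinv x -> svalid (step x i) ->
  slabel (step x i) =
    let pc := redex (sterm x) (scount x).-1 in
    replace_at (sterm x) pc.1 (subst pc.2 (label T (rcons (saddr x) i))).
Proof.
move=> ix vi; have := step_inv (fun _ => ix) vi; move: vi.
rewrite /step; case: ifP => du /= /and3P[_ k0 _] [/= Hx _ _ _].
  exact: slabel_start.
by rewrite /slabel /=; case: (scount x) k0.
Qed.

Lemma svalid_step x i : svalid (step x i) =
  [&& svalid x, (0 < scount x)%N & (i < deg T (saddr x))%N].
Proof. by rewrite /step; case: ifP. Qed.

Lemma sprob_step x i : sprob (step x i) =
  sprob x * (prob T (rcons (saddr x) i) / prob T (saddr x)).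
Proof. by rewrite /step; case: ifP. Qed.

Lemma prob_rcons_le u i : node T (rcons u i) -> prob T (rcons u i) <= prob T u.
Proof.
move=> nui; have nu := rst_prefix nui.
have id : (i < deg T u)%N by apply/node_rcons.
have d0 : (0 < deg T u)%N by apply: leq_ltn_trans id.
rewrite -(sum_prob_children nu d0) (bigD1_seq i) ?iota_uniq ?mem_iota //=.
rewrite lerDl big_seq_cond; apply: sumr_ge0 => j /andP[].
by rewrite mem_iota add0n => /node_rcons/prob_ge0.
Qed.

Lemma replay_prob_le1 w : svalid (replay w) -> sprob (replay w) <= 1.
Proof.
elim/last_ind: w => [//|w i IH].
rewrite replay_rcons svalid_step sprob_step => /and3P[vw _ id].
have [_ nu _ pw] := replay_inv vw.
have nui : node T (rcons (saddr (replay w)) i) by apply/node_rcons.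
apply: mulr_ile1; rewrite ?IH ?(ltW pw) //.
  by rewrite divr_ge0 ?prob_ge0.
by rewrite ler_pdivrMr ?prob_gt0 // mul1r prob_rcons_le.
Qed.

(** Each step of [T] is lifted by [prewrites_subst_ctx], and the factor [sprob] cancels in the
    ratios. The tree stops exactly when no tracked occurrence is left. *)
Lemma replay_children w : svalid (replay w) ->
  (forall i, ~ svalid (replay (rcons w i))) \/
  exists k : nat,
    (forall i, svalid (replay (rcons w i)) <-> (i < k)%N) /\
    prewrites P (slabel (replay w))
      [seq (sprob (replay (rcons w i)) / sprob (replay w),
            slabel (replay (rcons w i))) | i <- iota 0 k].
Proof.
move=> vw; have iw := replay_inv vw; have [Hw nw dw pw] := iw.
case: (posnP (scount (replay w))) => k0; [left|right].
  by move=> i; rewrite replay_rcons svalid_step k0 /= andbF.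
have vi i : svalid (replay (rcons w i)) = (i < deg T (saddr (replay w)))%N.
  by rewrite replay_rcons svalid_step vw k0.
exists (deg T (saddr (replay w))); split=> [i|]; first by rewrite vi.
have := deg_prewrites dw; move: (replay w) Hw k0 iw vi pw (replay_rcons w).
move=> x Hx k0 ix vi px wi dx.
have Hk : has_NO t (sterm x) (scount x).-1.+1 by rewrite prednK.
have [sig sE _] := redexP Hk.
have := prewrites_subst_ctx sig _ dx => /(_ (sterm x) (redex (sterm x) (scount x).-1).1).
rewrite sE => /(_ isT); set l := [seq _ | _ <- _]; set l' := [seq _ | _ <- _].
have -> : l = l'.
  rewrite /l /l' -map_comp; apply/eq_in_map => i; rewrite mem_iota add0n /= => id.
  rewrite wi sprob_step [X in _ = (X, _)]mulrC mulKf ?gt_eqF // slabel_step //.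
  by rewrite -wi vi.
by rewrite /slabel; case: (scount x) k0.
Qed.

Lemma replay_root_prob : sprob (replay [::]) = 1.
Proof. by []. Qed.

Lemma replay_prefix w i : svalid (replay (rcons w i)) -> svalid (replay w).
Proof. by rewrite replay_rcons svalid_step => /and3P[]. Qed.

Lemma replay_prob w : svalid (replay w) -> 0 < sprob (replay w) <= 1.
Proof.
by move=> vw; rewrite replay_prob_le1 // andbT; have [] := replay_inv vw.
Qed.

Definition replay_rst : rst P :=
  @Rst R Sigma ar V P (fun w => svalid (replay w)) (fun w => sprob (replay w))
    (fun w => slabel (replay w)) isT replay_prefix replay_root_prob
    replay_prob replay_children.

Lemma deg_replay w : svalid (replay w) ->
  deg replay_rst w =
    if scount (replay w) == 0%N then 0%N else deg T (saddr (replay w)).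
Proof.
move=> vw; set d := RHS.
have H i : (i < deg replay_rst w)%N = (i < d)%N.
  apply/idP/idP => [/node_rcons|id]; last apply/node_rcons;
    rewrite /= replay_rcons svalid_step vw /d lt0n; first by case: eqP.
  by move: id; rewrite /d; case: eqP.
move: (deg _ _) (d) H => a b H.
by apply/eqP; rewrite eqn_leq [(a <= b)%N]leqNgt [(b <= a)%N]leqNgt (H b) -(H a) !ltnn.
Qed.

Lemma replay_bound (th d : R) : 0 < th -> th < 1 -> 0 <= d ->
  leaf_below T (fun v => prob T v * th ^+ maxNO t (label T v)) [::] <= th + d ->
  forall n, 1 <= th + mass replay_rst n + d * \sum_(k < n) mass replay_rst k.+1.
Proof.
move=> th0 th1 d0; set g := (fun v => _) => fth n.
have g01 v : leaf T v -> 0 <= g v <= prob T v.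
  move=> lv; have p0 := leaf_prob_ge0 lv.
  by rewrite mulr_ge0 ?exprn_ge0 ?(ltW th0) //= ler_piMr // exprn_ile1 // ltW.
(* The factor [th ^+ k] stands for the waiting occurrences. Inside a copy, the active one
   contributes the conditional expectation of [th ^+ maxNO] over the leaves below the address, which
   does not increase on average; at the root of a copy it contributes [th] instead. *)
pose H x := if scount x is k.+1 then
    th ^+ k * (if saddr x == [::] then th else leaf_below T g (saddr x) / prob T (saddr x))
  else 1.
have H0 x : sinv x -> 0 <= H x.
  move=> [_ nx _ _]; rewrite /H; case: (scount x) => // k.
  rewrite mulr_ge0 ?exprn_ge0 ?(ltW th0) //; case: ifP => _; first exact: ltW.
  by rewrite divr_ge0 ?leaf_below_ge0 ?prob_ge0.
have Hroot : H (replay [::]) = th by rewrite /H /= expr0 mul1r.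
rewrite -Hroot; apply: (@potential_bound _ _ _ _ _ replay_rst (fun w => H (replay w))).
- by move=> w /= /replay_inv; exact: H0.
- move=> w /leafE[/= vw]; rewrite deg_replay // /H.
  have [_ _ + _] := replay_inv vw.
  by case: (scount (replay w)) => //= k + E; rewrite E.
move=> w /= vw; rewrite deg_replay //; have := replay_inv vw.
case kE : (scount (replay w)) => [//|k] /= iw _.
have [_ nu du pw] := iw; set x := replay w in vw kE iw nu du pw *.
set u := saddr x in nu du *.
have pu := prob_gt0 nu.
apply: (@le_trans _ _ (\sum_(i <- iota 0 (deg T u))
   sprob x / prob T u * th ^+ k * leaf_below T g (rcons u i))).
  rewrite big_seq [leRHS]big_seq; apply: ler_sum => i; rewrite mem_iota add0n => /= id.
  have nui : node T (rcons u i) by apply/node_rcons.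
  have pui := prob_gt0 nui.
  rewrite replay_rcons sprob_step -/x -/u -!mulrA ler_pM2l //.
  rewrite mulrCA ler_pM2l ?invr_gt0 //.
  rewrite /H /step -/u; case: ifP => dui /=; last first.
    rewrite kE (_ : rcons u i == [::] = false); last by case: (u).
    by rewrite mulrCA [_ / _]mulrC mulVKf ?gt_eqF.
  rewrite kE /=; set xi := maxNO _ _.
  (* The stopped value 1 is [th ^+ 0], so both branches are the same power of [th]. *)
  have -> : match (k + xi)%N with | 0%N => 1 | k0.+1 => th ^+ k0 * (if true then th else
     leaf_below T g [::] / prob T [::]) end = th ^+ (k + xi).
    by case: (k + xi)%N => [|j]; rewrite ?expr0 // exprSr.
  rewrite exprD mulrCA ler_pM2l ?exprn_gt0 //.
  by apply: leaf_below_leaf => //; apply/leafE; split=> //; apply/eqP.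
rewrite -mulr_sumr -!mulrA ler_pM2l //.
apply: (@le_trans _ _ (th ^+ k * (leaf_below T g u / prob T u))).
  rewrite mulrCA ler_pM2l ?exprn_gt0 // mulrC ler_pM2r ?invr_gt0 //.
  exact: sum_leaf_below.
(* Inside a copy [d] is mere slack. At its root [fth] applies, and [th ^+ k <= 1] keeps the increase
   within [d]. *)
rewrite /H kE -/u; case: eqP => [->|_]; last by rewrite lerDl.
rewrite rst_prob_root divr1.
have t0 : 0 < th ^+ k by rewrite exprn_gt0.
have t1 : th ^+ k <= 1 by rewrite exprn_ile1 // ltW.
apply: (@le_trans _ _ (th ^+ k * (th + d))); first by rewrite ler_pM2l.
by rewrite mulrDr lerD2l ler_piMl.
Qed.

End Replay.

(** * Existence of the replayed tree and conclusion *)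

Lemma height_gt0_deg (R : realType) (Sigma : finType) (ar : Sigma -> nat)
    (V : Type) (P : ptrs R ar V) (T : rst P) :
  (0 < height T)%E -> (0 < deg T [::])%N.
Proof.
move=> h0; rewrite lt0n; apply/eqP => d0; move: h0; apply/negP.
rewrite -leNgt; apply: ge_ereal_sup => _ [[|i v] nv <-] //=.
have /node_rcons : node T (rcons [::] i) by apply: (@node_cat _ _ _ _ _ T _ v).
by rewrite d0.
Qed.

(** [T'] is fixed before [th] and [d], because in the PAST case [th] is picked only after a bound
    attached to [T']. The root label is not a variable since it is rewritten. *)
Lemma exists_replay (R : realType) (Sigma : finType) (ar : Sigma -> nat)
    (V : Type) (P : ptrs R ar V) (T : rst P) :
  non_variable_decreasing T -> (0 < height T)%E ->
  exists T' : rst P, forall th d : R, 0 < th -> th < 1 -> 0 <= d ->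
    leaf_below T (fun v => prob T v * th ^+ maxNO (label T [::]) (label T v)) [::]
      <= th + d ->
    forall n, 1 <= th + mass T' n + d * \sum_(k < n) mass T' k.+1.
Proof.
move=> nvd /height_gt0_deg d0.
have Nv : ~ is_var (label T [::]).
  by move=> [x xE]; have := deg_prewrites d0; rewrite xE; exact: prewrites_nonvar.
have [redex redexP] : { redex : Defs.term ar V * nat -> seq nat * (V -> Defs.term ar V) &
    forall sk, has_NO (label T [::]) sk.1 sk.2.+1 ->
      replaceable (label T [::]) sk.1 sk.2 (redex sk) }.
  apply: (choice (P := fun sk pc => has_NO (label T [::]) sk.1 sk.2.+1 ->
    replaceable (label T [::]) sk.1 sk.2 pc)) => -[s k] /=.
  case: (pselect (has_NO (label T [::]) s k.+1)) => [Hs|Ns].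
    by have [pc pcP] := has_NO_replace Nv Hs; exists pc.
  by exists ([::], fun x => Var ar x).
exists (@replay_rst _ _ _ _ _ T (fun s k => redex (s, k)) Nv d0
  (fun s k => redexP (s, k)) nvd).
exact: replay_bound.
Qed.

Theorem theorem14 (R : realType) (Sigma : finType) (ar : Sigma -> nat)
  (V : Type) (P : ptrs R ar V) (T : rst P) (t : term ar V)
  (Hroot : label T [::] = t)
  (Hnvd : non_variable_decreasing T)
  (Hheight : (0 < height T)%E) :
  ((1 < \esum_(v in leaf T) (prob T v * (maxNO t (label T v))%:R)%:E)%E ->
     ~ AST P) /\
  ((1 <= \esum_(v in leaf T) (prob T v * (maxNO t (label T v))%:R)%:E)%E ->
     ~ PAST P).
Proof.
subst t; have [T' T'P] := exists_replay Hnvd Hheight.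
split=> [/exists_theta[th [th0 th1 fth]] /(_ T') ast|m1 past].
  (* With [c = 1] the bound holds for [d = 0] and reads [1 <= th + mass T' n], which fails once the
     remaining mass is below [1 - th]. *)
  have [n] : exists n, mass T' n < 1 - th.
    by apply: mass_cvg0; rewrite ?ast ?subr_gt0.
  have := T'P th 0 th0 th1 (lexx 0) _ n; rewrite addr0 mul0r addr0 => H.
  have /H : leaf_below T (fun v => prob T v * th ^+ maxNO (label T [::]) (label T v))
      [::] <= th by apply: le_trans fth _; lra.
  lra.
have fin := past T'.
have m1' : (1 <= leaf_mass T')%E.
  by move: fin; rewrite /edl; case: (ltP (leaf_mass T') 1%E) => // _; rewrite ltxx.
have [D [D0 DP]] := sum_mass_bounded fin.
(* Taking [c = 1 - b] gives [d = b * (1 - th)], hence [d * D <= (1 - th) / 2] whatever [th] turns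
   out to be. *)
pose b : R := (2 * (D + 1))^-1.
have b0 : 0 < b by rewrite invr_gt0; lra.
have bD : b * D <= 2^-1.
  have -> : b = 2^-1 * (D + 1)^-1 by rewrite /b invfM.
  rewrite -mulrA ler_piMr ?invr_ge0 // mulrC ler_pdivrMr; lra.
have /exists_theta[th [th0 th1 fth]] : ((1 - b)%:E <
    \esum_(v in leaf T) (prob T v * (maxNO (label T [::]) (label T v))%:R)%:E)%E.
  by apply: lt_le_trans m1; rewrite lte_fin; lra.
(* The remaining mass stays strictly below the other half of [1 - th], which contradicts the
   bound. *)
have [n mn] : exists n, mass T' n < (1 - th) / 2.
  by apply: mass_cvg0 => //; lra.
have bth0 : 0 <= b * (1 - th) by rewrite mulr_ge0 ?subr_ge0 ?ltW.
have bthE : th + b * (1 - th) = 1 - (1 - b) * (1 - th) by ring.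
have := T'P th _ th0 th1 bth0 _ n; rewrite bthE => /(_ fth).
have : b * (1 - th) * \sum_(k < n) mass T' k.+1 <= b * (1 - th) * D.
  by rewrite ler_wpM2l.
have : (1 - th) * (b * D) <= (1 - th) * 2^-1 by rewrite ler_wpM2l //; lra.
lra.
Qed.
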